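(* Let $G=\mathcal{K}_n$ be the complete graph on $n\ge 4$ vertices, let $K$ be a field, and let $h_i=\dim_K A(G)_i$, $i\ge 0$, be the entries of the $h$-vector of the Eulerian Artinian algebra $A(G)$. Then: (1) $h_1=\binom{n}{2}$, $h_3=1+\binom{n}{4}+\binom{n}{6}$ and, if $i\neq 1,3$, $h_i=\binom{n}{2i-2}+\binom{n}{2i}$. (2) If $n$ is odd, the socle pairs of $G$ are $(\emptyset,1)$ together with the pairs $(T,\frac{n+1}{2}+2\mathbb{Z})$, where $T\subseteq V_G$ is any subset of cardinality $n-1$. In particular, $A(G)$ is of type $n+1$ and the sequence of socle degrees is $3,\frac{n+1}{2},\dots,\frac{n+1}{2}$ (with $\frac{n+1}{2}$ listed $n$ times). (3) If $n$ is even, the set of socle pairs of $G$ is $\{(\emptyset,1),(V_G,0),(V_G,1)\}$. In particular, $A(G)$ is of type $3$ and the sequence of socle degrees is $3,\frac{n}{2},\frac{n}{2}+1$.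
   Context: For a finite simple graph $G$ with vertex set $V_G$ and non-empty edge set $E_G$ (each edge a 2-element subset of $V_G$) and any field $K$, $K[E_G]=K[t_e : e\in E_G]$ is the standard graded polynomial ring, with irrelevant ideal $\mathfrak m=(t_e: e\in E_G)$. For $J\subseteq E_G$, $\mathbf{t}_J=\prod_{e\in J}t_e$. $\triangle$ denotes symmetric difference of sets. Binomial coefficients $\binom{a}{k}$ are zero when $k<0$ or $k>a$. For $C\subseteq E_G$ and $v\in V_G$, $\deg_C(v)$ is the number of edges of $C$ containing $v$. $C$ is Eulerian if $\deg_C(v)$ is even for every $v\in V_G$. An Eulerian binomial is $\mathbf{t}_J-\mathbf{t}_L$ where $J,L\subseteq E_G$ are non-empty, $J\cap L=\emptyset$, $|J|=|L|$ and $J\cup L$ is Eulerian. $I(G)$ is the ideal of $K[E_G]$ generated by all Eulerian binomials and all $t_e^2$, $e\in E_G$; $A(G)=K[E_G]/I(G)$ is the Eulerian Artinian algebra of $G$. The socle of $A(G)$ is the graded submodule $\{u\in A(G) : \mathfrak m u=0\}$; its dimension over $K$ is the type of $A(G)$; the socle degrees are the degrees of the elements of a minimal homogeneous generating set (equivalently a homogeneous $K$-basis) of the socle, listed with multiplicity. For $T\subseteq V_G$, a subset $J\subseteq E_G$ is a $T$-join if $T=\{v\in V_G : \deg_J(v)\text{ is odd}\}$. For $p\in\mathbb{Z}_2=\mathbb{Z}/2\mathbb{Z}$ (elements written $0,1$), a $(T,p)$-join is a $T$-join $J$ with $|J|+2\mathbb{Z}=p$. $\mathcal{T}_{\mathrm{p},G}$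 is the set of pairs $(T,p)$ admitting a $(T,p)$-join; for such a pair, $\tau(T,p)$ is the minimum cardinality of a $(T,p)$-join. A pair $(T,p)\in\mathcal{T}_{\mathrm{p},G}$ is a socle pair of $G$ if $\tau(T\triangle e,p+1)=\tau(T,p)-1$ for every $e\in E_G$, where $e$ is regarded as a subset of $V_G$. *)

(* Defs.v *)
From HB Require Import structures.
From mathcomp Require Import all_boot all_order all_algebra.
From mathcomp Require Import ring_quotient generic_quotient.
From mathcomp Require Import boolp.
From mathcomp Require Import mpoly.

Set Implicit Arguments.
Unset Strict Implicit.
Unset Printing Implicit Defensive.

Import GRing.Theory.
Local Open Scope ring_scope.

(** * Graphs *)

Record sgraph (V : finType) := SGraph {
  edges : {set {set V}};
  edges_card2 : forall e, e \in edges -> #|e| = 2%N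
}.

Notation edge G := {e : {set _} | e \in edges G}.

Definition complete_edges (V : finType) : {set {set V}} :=
  [set e : {set V} | #|e| == 2%N].

Lemma complete_edges_card2 (V : finType) (e : {set V}) :
  e \in complete_edges V -> #|e| = 2%N.
Proof. by rewrite inE => /eqP. Qed.

Definition complete_graph (V : finType) : sgraph V :=
  SGraph (@complete_edges_card2 V).

(** * Joins and socle pairs *)

Definition symdiff (T : finType) (A B : {set T}) : {set T} :=
  (A :\: B) :|: (B :\: A).

Section Joins.
Variables (V : finType) (G : sgraph V).
Implicit Types (C J : {set edge G}) (T : {set V}) (p : 'Z_2).

Definition edeg C (v : V) : nat := #|[set e in C | v \in val e]|.

Definition eulerian C : bool := [forall v, ~~ odd (edeg C v)].

Definition is_tjoin T J : bool := T == [set v | odd (edeg J v)].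

Definition is_tpjoin T p J : bool := is_tjoin T J && (#|J|%:R == p).

Definition tp_pairs : {set {set V} * 'Z_2} :=
  [set x | [exists J, is_tpjoin x.1 x.2 J]].

(** The neutral value [#|{: edge G}|] bounds every [#|J|], so this is the exact
    minimum as soon as [(T, p) \in tp_pairs]. *)
Definition tau T p : nat :=
  \big[minn/#|{: edge G}|]_(J : {set edge G} | is_tpjoin T p J) #|J|.

(** [tau (symdiff T e) (p + 1) = tau T p - 1] is written additively to avoid
    truncated subtraction. The pair [(symdiff T e, p + 1)] is in [tp_pairs]
    whenever [(T, p)] is: replace a join [J] by [symdiff J [set e]]. *)
Definition socle_pairs : {set {set V} * 'Z_2} :=
  [set x in tp_pairs |
     [forall e : edge G,
        (tau (symdiff x.1 (val e)) (x.2 + 1)).+1 == tau x.1 x.2]].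

End Joins.

(** * Ideals and dimensions *)

Definition ideal_gen (R : comNzRingType) (S : R -> Prop) (x : R) : Prop :=
  exists2 s : seq (R * R),
    forall y, y \in s -> S y.2 & x = \sum_(y <- s) y.1 * y.2.

Section Dimension.
Variables (K : fieldType) (U : lmodType K) (S : U -> Prop).

Definition is_basis d (b : 'I_d -> U) : Prop :=
  [/\ forall i, S (b i),
      forall c : 'I_d -> K, \sum_i c i *: b i = 0 -> forall i, c i = 0
    & forall u, S u -> exists c : 'I_d -> K, u = \sum_i c i *: b i].

Definition has_dim (d : nat) : Prop := exists b : 'I_d -> U, is_basis b.

End Dimension.

(** * The Eulerian Artinian algebra *)

(** K[E_G]: the variables are indexed by the ranks of the edges. *)
Notation edge_ring K G := {mpoly K[#|{: edge G}|]}.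

Section EulerianAlgebra.
Variables (K : fieldType) (V : finType) (G : sgraph V).

Local Notation edge_ring := (edge_ring K G).

Definition tvar (e : edge G) : edge_ring := 'X_(enum_rank e).

Definition tmon (J : {set edge G}) : edge_ring := \prod_(e in J) tvar e.

Definition irrelevant_ideal : edge_ring -> Prop :=
  ideal_gen (fun x => exists e, x = tvar e).

Definition eulerian_binomial (x : edge_ring) : Prop :=
  exists J L : {set edge G},
    [/\ J != set0 /\ L != set0, [disjoint J & L], #|J| = #|L|,
        eulerian (J :|: L) & x = tmon J - tmon L].

Definition eulerian_generator (x : edge_ring) : Prop :=
  eulerian_binomial x \/ exists e, x = tvar e ^+ 2.

Definition eulerian_ideal : {pred edge_ring} :=
  fun x => `[< ideal_gen eulerian_generator x >].

Lemma tmon_coeff0 J : J != set0 -> (tmon J)@_0%MM = 0.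
Proof.
case/set0Pn=> e eJ; rewrite /tmon (big_setD1 e) //= /tvar.
by rewrite [LHS](rmorphM (mcoeff 0%MM)) /= mcoeffX mnm1_eq0 mul0r.
Qed.

Lemma eulerian_generator_coeff0 x : eulerian_generator x -> x@_0%MM = 0.
Proof.
case=> [[J [L [[J0 L0] _ _ _ ->]]]|[e ->]].
  by rewrite mcoeffB !tmon_coeff0 // subrr.
by rewrite rmorphXn /= /tvar mcoeffX mnm1_eq0 expr0n.
Qed.

Lemma eulerian_ideal_closed : idealr_closed eulerian_ideal.
Proof.
split.
- by apply/asboolP; exists [::]; rewrite ?big_nil.
- apply/asboolP=> -[s sS] /(congr1 (mcoeff 0%MM)).
  rewrite mcoeff1 eqxx raddf_sum big_seq big1 => [/eqP|y ys].
    by rewrite oner_eq0.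
  by rewrite [LHS](rmorphM (mcoeff 0%MM)) /= (eulerian_generator_coeff0 (sS _ ys)) mulr0.
- move=> a x y /asboolP[s sS ->] /asboolP[r rS ->]; apply/asboolP.
  exists ([seq (a * z.1, z.2) | z <- s] ++ r).
    by move=> z; rewrite mem_cat => /orP[/mapP[w /sS ? ->]|/rS].
  rewrite big_cat big_map mulr_sumr; congr (_ + _).
  by apply: eq_bigr => z _; rewrite mulrA.
Qed.

HB.instance Definition _ :=
  isIdealr.Build edge_ring eulerian_ideal eulerian_ideal_closed.

Definition eulerian_algebra := {ideal_quot eulerian_ideal}.

HB.instance Definition _ := GRing.ComNzRing.on eulerian_algebra.

Definition eproj : edge_ring -> eulerian_algebra :=
  \pi_({ideal_quot eulerian_ideal})%qT.

HB.instance Definition _ := GRing.RMorphism.on eproj.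

Definition escale (c : K) (u : eulerian_algebra) : eulerian_algebra :=
  eproj c%:MP * u.

Lemma escaleA c d u : escale c (escale d u) = escale (c * d) u.
Proof. by rewrite /escale mulrA -rmorphM -mpolyCM. Qed.

Lemma escale1 : left_id 1 escale.
Proof. by move=> u; rewrite /escale mpolyC1 rmorph1 mul1r. Qed.

Lemma escaleDr : right_distributive escale +%R.
Proof. by move=> c u w; rewrite /escale mulrDr. Qed.

Lemma escaleDl u : {morph escale^~ u : c d / c + d}.
Proof. by move=> c d; rewrite /escale mpolyCD rmorphD mulrDl. Qed.

HB.instance Definition _ := GRing.Zmodule_isLmodule.Build K eulerian_algebra
  escaleA escale1 escaleDr escaleDl.

Lemma escaleAl c (u w : eulerian_algebra) : c *: (u * w) = (c *: u) * w.
Proof. exact: mulrA. Qed.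

HB.instance Definition _ :=
  GRing.Lmodule_isLalgebra.Build K eulerian_algebra escaleAl.

HB.instance Definition _ :=
  GRing.Lalgebra_isComAlgebra.Build K eulerian_algebra.

Definition graded_part (i : nat) (u : eulerian_algebra) : Prop :=
  exists2 x : edge_ring, x \is i.-homog & u = eproj x.

Definition socle (u : eulerian_algebra) : Prop :=
  forall x, irrelevant_ideal x -> eproj x * u = 0.

Definition has_type (d : nat) : Prop := has_dim socle d.

(** [s] lists, in some order, the degrees of a homogeneous basis of the socle. *)
Definition socle_degrees (s : seq nat) : Prop :=
  exists2 b : 'I_(size s) -> eulerian_algebra,
    is_basis socle b
         & forall i : 'I_(size s), graded_part (nth 0%N s i) (b i).

End EulerianAlgebra.

(** Binomial coefficients with an integer lower index: zero when [k < 0]. *)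
Definition binz (a : nat) (k : int) : nat :=
  if k is Posz m then 'C(a, m) else 0%N.

(* Main.v *)
(** A monomial that is not squarefree vanishes in [A(G)]; the class of [t_J] depends
    only on [#|J|] and on the pair [(T, p)] of which [J] is a join, and it vanishes
    unless [J] has minimum cardinality among the [(T, p)]-joins. Conversely, summing the
    coefficients of the [t_J] over the minimum [(T, p)]-joins [J] gives a linear form
    that kills [I(G)]. Hence the classes of one minimum join for every pair form a
    homogeneous basis of [A(G)], with degrees [tau]. Multiplication by [t_e] sends
    the basis vector of [(T, p)] to that of [(T + e, p + 1)] or to [0], according to
    whether [tau] goes up or down, and distinct pairs have distinct images; so the
    socle is spanned by the basis vectors of the socle pairs.

    For the complete graph, [2 #|J| >= #|T|] for every [T]-join [J], so [tau(T, p)] is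
    at least whichever of [#|T|/2], [#|T|/2 + 1] has parity [p]. This bound is attained
    for all [T <> set0], by removing pairs of vertices from [T]; the only exception is
    [tau(set0, 1) = 3], attained by a triangle. *)

From HB Require Import structures.
Require Import Defs.
From mathcomp Require Import all_boot all_order all_algebra.
From mathcomp Require Import ring_quotient generic_quotient boolp mpoly zify.

Set Implicit Arguments.
Unset Strict Implicit.
Unset Printing Implicit Defensive.

Import GRing.Theory.
Local Open Scope ring_scope.

(** * Symmetric differences and parities in ['Z_2] *)

Lemma in_symdiff (T : finType) (A B : {set T}) x :
  (x \in symdiff A B) = (x \in A) (+) (x \in B).
Proof. by rewrite !inE; case: (x \in A); case: (x \in B). Qed.

Lemma symdiff_disjoint (T : finType) (A B : {set T}) :
  [disjoint A & B] -> symdiff A B = A :|: B.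
Proof.
move=> dAB; apply/setP=> x; rewrite in_symdiff inE.
by case: (boolP (x \in A)) => // /(disjointFr dAB) ->.
Qed.

Lemma symdiffK (T : finType) (A B : {set T}) : symdiff (symdiff A B) B = A.
Proof. by apply/setP=> x; rewrite !in_symdiff addbK. Qed.

Lemma symdiff0s (T : finType) (A : {set T}) : symdiff set0 A = A.
Proof. by apply/setP=> x; rewrite in_symdiff inE. Qed.

Lemma symdiffss (T : finType) (A : {set T}) : symdiff A A = set0.
Proof. by apply/setP=> x; rewrite in_symdiff inE addbb. Qed.

Lemma disjointDD (T : finType) (A B : {set T}) : [disjoint A :\: B & B :\: A].
Proof.
rewrite -setI_eq0; apply/eqP/setP=> x; rewrite !inE.
by case: (x \in A); case: (x \in B).
Qed.

Lemma cards_symdiff (T : finType) (A B : {set T}) :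
  (#|symdiff A B| + (#|A :&: B|).*2 = #|A| + #|B|)%N.
Proof.
rewrite /symdiff cardsU (disjoint_setI0 (disjointDD A B)) cards0.
rewrite -(cardsID B A) -(cardsID A B) (setIC B A); lia.
Qed.

Lemma odd_cards_symdiff (T : finType) (A B : {set T}) :
  odd #|symdiff A B| = odd #|A| (+) odd #|B|.
Proof.
by rewrite -oddD -cards_symdiff oddD odd_double addbF.
Qed.

Lemma eq_natr_Z2 (a b : nat) : (a%:R == b%:R :> 'Z_2) = (odd a == odd b).
Proof. by rewrite -val_eqE /= !val_Zp_nat // !modn2; case: (odd a); case: (odd b). Qed.

Lemma natr_Z2 (p : 'Z_2) : p = (odd p)%:R.
Proof. by apply/val_inj; case: p => -[|[|]]. Qed.

Lemma addr1K_Z2 (p : 'Z_2) : p + 1 + 1 = p.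
Proof. by rewrite (natr_Z2 p) !natr1; apply/eqP; rewrite eq_natr_Z2 /= negbK. Qed.

Lemma odd_Z2S (p : 'Z_2) : odd (p + 1)%R = ~~ odd p.
Proof. by case: p => -[|[|]]. Qed.

Lemma odd_natr_Z2 (d : nat) : odd (d%:R : 'Z_2) = odd d.
Proof. by rewrite val_Zp_nat // modn2; case: (odd d). Qed.

(** * Joins of a graph *)

Section Joins.
Variables (V : finType) (G : sgraph V).
Implicit Types (J L M : {set edge G}) (P : {set V} * 'Z_2) (e : edge G).

Definition odd_vertices J : {set V} := [set v | odd (edeg J v)].

Definition join_pair J : {set V} * 'Z_2 := (odd_vertices J, #|J|%:R).

(** How the pair of a join changes when [e] is toggled in it; on basis vectors, this is the index
    shift under multiplication by [t_e]. *)
Definition pair_step P e : {set V} * 'Z_2 := (symdiff P.1 (val e), P.2 + 1).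

Definition ptau P : nat := tau G P.1 P.2.

Definition min_join P J : bool := (join_pair J == P) && (#|J| == ptau P).

Lemma is_tpjoinE T p J : is_tpjoin T p J = (join_pair J == (T, p)).
Proof. by rewrite /is_tpjoin /is_tjoin xpair_eqE eq_sym. Qed.

Lemma tp_pairsP P : reflect (exists J, join_pair J = P) (P \in tp_pairs G).
Proof.
rewrite inE; apply: (iffP existsP) => -[J].
  by rewrite is_tpjoinE -surjective_pairing => /eqP; exists J.
by exists J; rewrite is_tpjoinE -surjective_pairing; apply/eqP.
Qed.

Lemma join_pair_in J : join_pair J \in tp_pairs G.
Proof. by apply/tp_pairsP; exists J. Qed.

Lemma odd_vertices_symdiff J L :
  odd_vertices (symdiff J L) = symdiff (odd_vertices J) (odd_vertices L).
Proof.
apply/setP=> v; rewrite in_symdiff !inE /edeg -odd_cards_symdiff.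
rewrite (_ : [set _ in _ | _] =
  symdiff [set e in J | v \in val e] [set e in L | v \in val e]) //.
apply/setP=> e; rewrite !(inE, in_symdiff).
by case: (v \in val e); rewrite ?andbT ?andbF.
Qed.

Lemma odd_vertices1 e : odd_vertices [set e] = val e.
Proof.
apply/setP=> v; rewrite inE /edeg; case: (boolP (v \in val e)) => ve.
  rewrite (_ : [set _ in _ | _] = [set e]) ?cards1 //.
  by apply/setP=> f; rewrite !inE; case: eqP => // ->.
rewrite (_ : [set _ in _ | _] = set0) ?cards0 //.
by apply/setP=> f; rewrite !inE; case: eqP => // ->; apply/negbTE.
Qed.

Lemma odd_vertices0 : odd_vertices set0 = set0.
Proof. by rewrite -(symdiffss set0) odd_vertices_symdiff symdiffss. Qed.

Lemma eulerianE J : eulerian J = (odd_vertices J == set0).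
Proof.
apply/forallP/eqP => [evJ|J0 v]; last by move/setP/(_ v): J0; rewrite !inE => ->.
by apply/setP=> v; rewrite !inE; apply/negbTE.
Qed.

Lemma join_pair_symdiff J L :
  join_pair (symdiff J L) =
  (symdiff (odd_vertices J) (odd_vertices L), #|J|%:R + #|L|%:R).
Proof.
congr (_, _); first exact: odd_vertices_symdiff.
by rewrite -natrD; apply/eqP; rewrite eq_natr_Z2 odd_cards_symdiff oddD.
Qed.

Lemma join_pair_flip J e :
  join_pair (symdiff J [set e]) = pair_step (join_pair J) e.
Proof. by rewrite join_pair_symdiff odd_vertices1 cards1. Qed.

Lemma pair_stepK e : involutive (pair_step^~ e).
Proof. by case=> T p; rewrite /pair_step /= symdiffK addr1K_Z2. Qed.

Lemma pair_step_in P e : P \in tp_pairs G -> pair_step P e \in tp_pairs G.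
Proof. by case/tp_pairsP=> J <-; rewrite -join_pair_flip join_pair_in. Qed.

Lemma ptau_le J : (ptau (join_pair J) <= #|J|)%N.
Proof.
rewrite /ptau /tau -minEnat -leEnat.
by apply: (@Order.TotalTheory.bigmin_le_cond _ nat); rewrite is_tpjoinE /=.
Qed.

Lemma min_join_ex P : P \in tp_pairs G -> exists J, min_join P J.
Proof.
case/tp_pairsP=> J1 J1P.
case: (@arg_minnP _ J1 (fun J => join_pair J == P) (fun J => #|J|)).
  exact/eqP.
move=> J0 /eqP J0P J0min; exists J0; rewrite /min_join J0P eqxx /= eqn_leq.
rewrite -{2}J0P ptau_le andbT /ptau /tau.
(* The neutral value of the minimum is the number of all edges, which also bounds [#|J0|]. *)
apply: (big_ind (fun k => #|J0| <= k)%N) => [|a b|J]; first exact: max_card.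
  by rewrite leq_min => -> ->.
by rewrite is_tpjoinE -surjective_pairing; apply: J0min.
Qed.

Lemma min_join_pair P J : min_join P J -> join_pair J = P.
Proof. by case/andP=> /eqP. Qed.

Lemma min_join_card P J : min_join P J -> #|J| = ptau P.
Proof. by case/andP=> _ /eqP. Qed.

Lemma ptau_parity P : P \in tp_pairs G -> P.2 = (ptau P)%:R.
Proof. by case/min_join_ex=> J /andP[/eqP <- /eqP <-]. Qed.

(** Toggling [e] in a minimum join raises [ptau] by at most one. Used for [P] and, by involution,
    for [pair_step P e], this leaves a difference of at most one, and parity excludes zero. *)
Lemma ptau_step P e : P \in tp_pairs G ->
  ptau (pair_step P e) = (ptau P).+1 \/ (ptau (pair_step P e)).+1 = ptau P.
Proof.
move=> tpP.
have up Q : Q \in tp_pairs G -> (ptau (pair_step Q e) <= (ptau Q).+1)%N.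
  case/min_join_ex=> J /andP[/eqP <- /eqP <-]; rewrite -join_pair_flip.
  have := cards_symdiff J [set e]; rewrite cards1.
  by have := ptau_le (symdiff J [set e]); lia.
have := up _ (pair_step_in e tpP); rewrite pair_stepK.
have := up _ tpP; have := ptau_parity (pair_step_in e tpP).
rewrite /= (ptau_parity tpP) natr1 => /eqP; rewrite eq_natr_Z2 /=; lia.
Qed.

Lemma socle_pairsP P : reflect
  (P \in tp_pairs G /\ forall e, (ptau (pair_step P e)).+1 = ptau P)
  (P \in socle_pairs G).
Proof.
rewrite [P \in socle_pairs G]inE; apply: (iffP andP) => -[tpP].
  by move/forallP=> sP; split=> // e; apply/eqP/sP.
by move=> sP; split=> //; apply/forallP=> e; apply/eqP/sP.
Qed.

(** The symmetric difference of [M] and [L] is again a [P]-join, so it has at least [#|M| + #|J|]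
    elements. As [#|L| = #|J|], no room is left for [M] and [L] to meet. *)
Lemma min_join_exchange P M J L :
  #|J| = #|L| -> odd_vertices J = odd_vertices L ->
  [disjoint M & J] -> min_join P (M :|: J) ->
  [disjoint M & L] && min_join P (M :|: L).
Proof.
move=> cJL oJL dMJ mJ; rewrite -(symdiff_disjoint dMJ) in mJ.
have jL : join_pair (symdiff M L) = P.
  by rewrite -(min_join_pair mJ) !join_pair_symdiff cJL oJL.
have := min_join_card mJ; have := ptau_le (symdiff M L); rewrite jL => leL cJ.
have := cards_symdiff M L; have := cards_symdiff M J.
rewrite cJ (disjoint_setI0 dMJ) cards0 cJL => eJ eL.
have /eqP : #|M :&: L| = 0%N by lia.
rewrite cards_eq0 setI_eq0 => dML; rewrite dML /= -(symdiff_disjoint dML).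
rewrite /min_join jL eqxx /=; apply/eqP.
by move: eL; rewrite (disjoint_setI0 dML) cards0 -eJ => /addIn.
Qed.

End Joins.

(** * The Eulerian Artinian algebra *)

Section Algebra.
Variables (K : fieldType) (V : finType) (G : sgraph V).
Implicit Types (A B J L M : {set edge G}) (P Q : {set V} * 'Z_2) (e : edge G).
Implicit Types (x y : edge_ring K G) (u : eulerian_algebra K G).
Implicit Types (m : 'X_{1..#|{: edge G}|}).

Local Notation tmon J := (tmon K J).
Local Notation tvar e := (tvar K e).
Local Notation eproj := (@eproj K V G).
Local Notation ptau := (ptau G).

(** * Squarefree monomials and the coordinate forms *)

Definition mset J : 'X_{1..#|{: edge G}|} := [multinom (enum_val i \in J : nat) | i < _].

Lemma msetE J e : mset J (enum_rank e) = (e \in J).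
Proof. by rewrite mnmE enum_rankK. Qed.

Lemma mset_inj : injective mset.
Proof.
move=> J L eJL; apply/setP=> e; have := msetE J e.
by rewrite eJL msetE; case: (e \in J); case: (e \in L).
Qed.

Lemma tmonE J : tmon J = 'X_[mset J].
Proof.
rewrite mpolyXE_id (reindex enum_rank) /=; last first.
  by exists enum_val => i _; rewrite ?enum_rankK ?enum_valK.
rewrite /Defs.tmon big_mkcond; apply: eq_bigr => e _.
by rewrite msetE; case: (e \in J).
Qed.

Lemma mdeg_mset J : mdeg (mset J) = #|J|.
Proof.
rewrite mdegE (reindex enum_rank) /=; last first.
  by exists enum_val => i _; rewrite ?enum_rankK ?enum_valK.
rewrite -[RHS]sum1_card [RHS]big_mkcond; apply: eq_bigr => e _.
by rewrite msetE; case: (e \in J).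
Qed.

Lemma tmon_homog J : tmon J \is #|J|.-homog.
Proof. by rewrite tmonE dhomogX; apply/eqP/mdeg_mset. Qed.

(** Computations with polynomials reduce by linearity to monomials, and then to this dichotomy:
    squarefree, or a multiple of a generator [t_e ^+ 2]. *)
Lemma monomialP m :
  {J | m = mset J} + {e & {m' | 'X_[m] = 'X_[m'] * tvar e ^+ 2 :> edge_ring K G}}.
Proof.
case: (pickP (fun e => 1 < m (enum_rank e))%N) => [e me|mle1].
  right; exists e, (m - U_(enum_rank e) *+ 2)%MM.
  rewrite /Defs.tvar mpolyXn -mpolyXD submK //; apply/mnm_lepP => i.
  rewrite mulmnE mnm1E; case: eqP => // <-; lia.
left; exists [set e | m (enum_rank e) != 0%N]; apply/mnmP=> i.
rewrite mnmE inE enum_valK; have := mle1 (enum_val i); rewrite enum_valK.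
by case: (m i) => [|[]].
Qed.

Lemma tmonU J L : [disjoint J & L] -> tmon (J :|: L) = tmon J * tmon L.
Proof.
move=> dJL; rewrite /Defs.tmon (eq_bigl (fun e => (e \in J) || (e \in L))).
  by rewrite bigU.
by move=> e; rewrite inE.
Qed.

Lemma tmon1 e : tmon [set e] = tvar e.
Proof. by rewrite /Defs.tmon big_set1. Qed.

Lemma tmonM_square J L : ~~ [disjoint J & L] ->
  exists e x, tmon J * tmon L = x * tvar e ^+ 2.
Proof.
case/pred0Pn=> e /= /andP[eJ eL]; rewrite /Defs.tmon (big_setD1 e eJ) (big_setD1 e eL) /=.
set a := \prod_(i in _) _; set b := \prod_(i in _) _.
by exists e, (a * b); rewrite expr2 mulrACA mulrC.
Qed.

(** The coordinate of [x] on the class of the minimum [P]-joins. *)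
Definition coord P x : K := \sum_(J | min_join P J) x@_(mset J).

Lemma coord_is_linear P : linear_for *%R (coord P).
Proof.
move=> c x y; rewrite /coord mulr_sumr -big_split.
by apply: eq_bigr => J _; rewrite mcoeffD mcoeffZ.
Qed.

HB.instance Definition _ P :=
  GRing.isLinear.Build K (edge_ring K G) K _ (coord P) (coord_is_linear P).

Lemma coord_tmon P J : coord P (tmon J) = (min_join P J)%:R.
Proof.
rewrite /coord tmonE.
under eq_bigr => L _ do rewrite mcoeffX (inj_eq mset_inj).
case: (boolP (min_join P J)) => mJ.
  rewrite (bigD1 J) //= eqxx big1 ?addr0 // => L /andP[_ /negPf].
  by rewrite eq_sym => ->.
by rewrite big1 // => L mL; case: eqP => // eJL; rewrite eJL mL in mJ.
Qed.

Lemma coord_square P x e : coord P (x * tvar e ^+ 2) = 0.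
Proof.
rewrite [x]mpolyE mulr_suml linear_sum big1 //= => m _.
rewrite -scalerAl linearZ /= /Defs.tvar mpolyXn -mpolyXD /coord big1 ?mulr0 // => J _.
rewrite mcoeffX; case: eqP => // /mnmP/(_ (enum_rank e)).
(* The exponent at [e] is at least 2 on one side and at most 1 in [mset J]. *)
rewrite mnmDE mulmnE mnm1E eqxx msetE; case: (e \in J); lia.
Qed.

Lemma coord_tmonM P M J : coord P (tmon M * tmon J) =
  ([disjoint M & J] && min_join P (M :|: J))%:R.
Proof.
case: (boolP [disjoint M & J]) => dMJ /=; first by rewrite -tmonU // coord_tmon.
by have [e [x ->]] := tmonM_square dMJ; rewrite coord_square.
Qed.

Lemma odd_vertices_eulerianU J L : [disjoint J & L] -> eulerian (J :|: L) ->
  odd_vertices J = odd_vertices L.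
Proof.
move=> dJL; rewrite eulerianE -symdiff_disjoint // odd_vertices_symdiff => /eqP J0.
by rewrite -[LHS](symdiffK _ (odd_vertices L)) J0 symdiff0s.
Qed.

Lemma coord_ideal P x : x \in @eulerian_ideal K V G -> coord P x = 0.
Proof.
case/asboolP=> s sS ->; rewrite linear_sum big_seq big1 //= => -[a g] /sS /=.
case=> [[J [L [_ dJL cJL evJL ->]]]|[e ->]]; last exact: coord_square.
have oJL := odd_vertices_eulerianU dJL evJL.
rewrite [a]mpolyE mulr_suml linear_sum big1 //= => m _.
rewrite -scalerAl linearZ /=; case: (monomialP m) => [[M ->]|[e [m' ->]]].
  rewrite -tmonE mulrBr linearB /= !coord_tmonM.
  (* The exchange lemma, used in both directions, makes the coordinates of [t_M t_J] and [t_M t_L]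
     equal. *)
  rewrite (_ : _ && _ = [disjoint M & L] && min_join P (M :|: L)) ?subrr ?mulr0 //.
  apply/andP/idP => [[]|/andP[]]; first exact: min_join_exchange.
  by move=> dML mL; apply/andP; apply: min_join_exchange mL => //.
by rewrite mulrAC coord_square mulr0.
Qed.

(** * Relations between monomials in the quotient *)

Lemma eproj_eq0 x : (eproj x == 0) = (x \in @eulerian_ideal K V G).
Proof.
by rewrite -[x in RHS]subr0 Quotient.idealrBE -(rmorph0 eproj).
Qed.

Lemma eproj_square e : eproj (tvar e ^+ 2) = 0.
Proof.
apply/eqP; rewrite eproj_eq0; apply/asboolP; exists [:: (1, tvar e ^+ 2)].
  by move=> y; rewrite inE => /eqP -> /=; right; exists e.
by rewrite big_seq1 mul1r.
Qed.

Lemma eproj_squareM x e : eproj (x * tvar e ^+ 2) = 0.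
Proof. by rewrite rmorphM /= eproj_square mulr0. Qed.

Lemma eproj_tmon_eulerian J L : J != set0 -> L != set0 -> [disjoint J & L] ->
  #|J| = #|L| -> eulerian (J :|: L) -> eproj (tmon J) = eproj (tmon L).
Proof.
move=> J0 L0 dJL cJL evJL; apply/eqP; rewrite -subr_eq0 -rmorphB /= eproj_eq0.
apply/asboolP; exists [:: (1, tmon J - tmon L)].
  by move=> y; rewrite inE => /eqP -> /=; left; exists J, L.
by rewrite big_seq1 mul1r.
Qed.

Lemma eprojZ c x : eproj (c *: x) = c *: eproj x.
Proof. by rewrite -mul_mpolyC rmorphM. Qed.

Lemma eproj_surj u : exists x, u = eproj x.
Proof. by exists (repr u); rewrite /Defs.eproj reprK. Qed.

(** Hence [coord P] descends to a linear form on the quotient. *)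
Lemma coord_eq P x y : eproj x = eproj y -> coord P x = coord P y.
Proof.
move/eqP; rewrite -subr_eq0 -rmorphB eproj_eq0 => /(coord_ideal P)/eqP.
by rewrite linearB subr_eq0 => /eqP.
Qed.

(** An Eulerian binomial multiplied by [t_(J :\: A)]. The product is not merged into one [tmon],
    because [B] may meet [J :\: A]. *)
Lemma eproj_tmon_replace J A B : A \subset J -> A != set0 -> [disjoint A & B] ->
  #|A| = #|B| -> eulerian (A :|: B) ->
  eproj (tmon J) = eproj (tmon (J :\: A) * tmon B).
Proof.
move=> AJ A0 dAB cAB ev.
have B0 : B != set0 by rewrite -card_gt0 -cAB card_gt0.
rewrite rmorphM /= -(eproj_tmon_eulerian A0 B0) // -rmorphM /= -tmonU.
  by rewrite setUC setDE setUIr setUCr setIT; move/setUidPr: AJ => ->.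
by rewrite -setI_eq0 setDE -setIA (setIC (~: A)) setICr setI0.
Qed.

Lemma eulerian_symdiff J L : odd_vertices J = odd_vertices L ->
  eulerian (symdiff J L).
Proof. by move=> oJL; rewrite eulerianE odd_vertices_symdiff oJL symdiffss. Qed.

(** Exchange [J :\: L] for [L :\: J]: they have the same size and an Eulerian union. The empty case
    is separate since both sides of an Eulerian binomial are non-empty. *)
Lemma eproj_tmon_eq J L : odd_vertices J = odd_vertices L -> #|J| = #|L| ->
  eproj (tmon J) = eproj (tmon L).
Proof.
move=> oJL cJL; have cD : #|J :\: L| = #|L :\: J| by rewrite !cardsD cJL setIC.
have [JL0|JL0] := eqVneq (J :\: L) set0.
  suff -> : J = L by [].
  by apply/eqP; rewrite eqEcard cJL leqnn andbT -setD_eq0 JL0.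
rewrite (eproj_tmon_replace (subsetDl J L) JL0 (disjointDD J L) cD);
  last exact: eulerian_symdiff.
have -> : J :\: (J :\: L) = L :&: J by rewrite setDDr setDv set0U setIC.
rewrite -tmonU ?setID // -setI_eq0; apply/eqP/setP=> e; rewrite !inE.
by case: (e \in L); case: (e \in J).
Qed.

(** The symmetric difference of [J] and a shorter join [L] of the same pair splits
    into halves [A] and [B] with [A] properly contained in [J :\: L]; replacing
    [A] by [B] in [t_J] creates a square. *)
Lemma eproj_tmon_not_min J L : join_pair J = join_pair L -> (#|L| < #|J|)%N ->
  eproj (tmon J) = 0.
Proof.
case=> oJL /eqP; rewrite eq_natr_Z2 => pJL ltLJ.
have := cardsID L J; have := cardsID J L; rewrite setIC => cL cJ.
have cC : #|symdiff J L| = (#|J :\: L| + #|L :\: J|)%N.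
  by rewrite /symdiff cardsU (disjoint_setI0 (disjointDD J L)) cards0 subn0.
have oC := odd_cards_symdiff J L; rewrite (eqP pJL) addbb in oC.
have [k cCk] : exists k, #|symdiff J L| = k.*2.
  by exists #|symdiff J L|./2; rewrite even_halfK ?oC.
(* [L] is shorter, so [J :\: L] is more than half of the symmetric difference, and a half [A] fits
   properly inside it. *)
have [k0 ltk] : (0 < k)%N /\ (k < #|J :\: L|)%N.
  move: cCk cC cJ cL ltLJ; move: #|_| #|_| #|_| #|_| #|_| #|_|; lia.
have /card_geqP[s [us cs sJL]] := ltnW ltk.
pose A := [set e in s]; pose B := symdiff J L :\: A.
have cA : #|A| = k by rewrite cardsE (card_uniqP us).
have AJL : A \subset J :\: L by apply/subsetP=> e; rewrite inE => /sJL.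
have AC : A \subset symdiff J L by apply: subset_trans AJL (subsetUl _ _).
have cB := cardsD (symdiff J L) A; rewrite (setIidPr AC) in cB.
have AB : A :|: B = symdiff J L by rewrite /B -[X in X :|: _](setIidPr AC) setID.
have dAB : [disjoint A & B] by rewrite -setI_eq0 /B setIDA setDIl setDv set0I.
rewrite (eproj_tmon_replace (subset_trans AJL (subsetDl _ _)) _ dAB); first last.
- by rewrite AB eulerian_symdiff.
- by rewrite cB cA cCk -addnn addnK.
- by rewrite -card_gt0 cA.
(* An element of [J :\: L] left over by [A] lies both in [B] and in [J :\: A]. *)
suff /tmonM_square[e [x ->]] : ~~ [disjoint J :\: A & B] by apply: eproj_squareM.
have := cardsD (J :\: L) A; rewrite (setIidPr AJL) => cD.
have : (0 < #|(J :\: L) :\: A|)%N by rewrite cD cA subn_gt0.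
rewrite card_gt0 => /set0Pn[e]; rewrite !inE => /and3P[eA eL eJ].
by apply/pred0Pn; exists e; rewrite /= !inE eA eL eJ.
Qed.

(** * The basis of classes of minimum joins *)

Definition min_rep P : {set edge G} := odflt set0 [pick J | min_join P J].

Definition pair_vec P : eulerian_algebra K G := eproj (tmon (min_rep P)).

(** In particular the default [set0] of [min_rep] is never taken at a pair of [tp_pairs G]. *)
Lemma min_repP P : P \in tp_pairs G -> min_join P (min_rep P).
Proof.
move/min_join_ex=> [J mJ]; rewrite /min_rep.
by case: pickP => [//|/(_ J)]; rewrite mJ.
Qed.

Lemma coord_min_rep P Q : Q \in tp_pairs G -> coord P (tmon (min_rep Q)) = (P == Q)%:R.
Proof.
move/min_repP=> mQ; rewrite coord_tmon; case: eqVneq => [->|neq]; first by rewrite mQ.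
case: (boolP (min_join P _)) => // mP.
by case/eqP: neq; rewrite -(min_join_pair mP) (min_join_pair mQ).
Qed.

Lemma eproj_tmon J :
  eproj (tmon J) = (#|J| == ptau (join_pair J))%:R *: pair_vec (join_pair J).
Proof.
have mJ := min_repP (join_pair_in J).
have jJ := min_join_pair mJ; have cJ := min_join_card mJ.
case: eqP => eJ; rewrite ?scale1r ?scale0r.
  by case: jJ => oJ _; apply: eproj_tmon_eq; rewrite ?oJ ?cJ.
apply: (eproj_tmon_not_min (esym jJ)); rewrite cJ.
by have := ptau_le J; lia.
Qed.

(** It suffices to treat one monomial: with a square, both sides vanish; if it is [t_J], only the
    coordinate at [join_pair J] can be non-zero. *)
Lemma eproj_coord x : eproj x = \sum_(P in tp_pairs G) coord P x *: pair_vec P.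
Proof.
have coordE P : coord P x = \sum_(m <- msupp x) x@_m * coord P 'X_[m].
  by rewrite {1}[x]mpolyE linear_sum; apply: eq_bigr => m _; rewrite linearZ.
under [RHS]eq_bigr => P _ do rewrite coordE scaler_suml.
rewrite {1}[x]mpolyE rmorph_sum exchange_big; apply: eq_bigr => m _ /=.
under eq_bigr => P _ do rewrite -scalerA.
rewrite -scaler_sumr eprojZ; congr (_ *: _).
case: (monomialP m) => [[J ->]|[e [m' ->]]]; last first.
  by rewrite eproj_squareM big1 // => P _; rewrite coord_square scale0r.
rewrite -tmonE eproj_tmon (bigD1 (join_pair J)) ?join_pair_in //= coord_tmon.
rewrite /min_join eqxx /= big1 ?addr0 // => P /andP[_ neq].
by rewrite coord_tmon /min_join eq_sym (negPf neq) scale0r.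
Qed.

(** A common criterion for the graded parts and the socle. Independence follows by applying [coord],
    generation by dropping the vanishing terms of [eproj_coord]. *)
Lemma pair_vec_basis (S : eulerian_algebra K G -> Prop) (r : seq ({set V} * 'Z_2)) P0 :
  uniq r -> {subset r <= tp_pairs G} ->
  (forall P, P \in r -> S (pair_vec P)) ->
  (forall x P, S (eproj x) -> P \in tp_pairs G -> P \notin r -> coord P x = 0) ->
  is_basis S (fun i : 'I_(size r) => pair_vec (nth P0 r i)).
Proof.
move=> ur tpr Sr S0; split=> [i|c c0 i|u Su]; first by apply/Sr/mem_nth.
  have : eproj (\sum_i c i *: tmon (min_rep (nth P0 r i))) = eproj 0.
    by rewrite rmorph_sum rmorph0 -[RHS]c0; apply: eq_bigr => j _; apply: eprojZ.
  move/(coord_eq (nth P0 r i)); rewrite linear0 linear_sum /= (bigD1 i) //= big1.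
    by rewrite linearZ /= coord_min_rep ?tpr ?mem_nth // eqxx mulr1 addr0.
  move=> j neq; rewrite linearZ /= coord_min_rep ?tpr ?mem_nth // nth_uniq //.
  by rewrite (inj_eq val_inj) eq_sym (negPf neq) mulr0.
have [x eu] := eproj_surj u; rewrite eu in Su *.
exists (fun i : 'I_(size r) => coord (nth P0 r i) x); rewrite eproj_coord.
rewrite (bigID (mem r)) /= [X in _ + X]big1 ?addr0; last first.
  by move=> P /andP[tpP rP]; rewrite (S0 x) ?scale0r.
rewrite (eq_bigl (mem r)); last first.
  by move=> P /=; case: (boolP (P \in r)) => [/tpr ->|]; rewrite ?andbF.
by rewrite -big_uniq // (big_nth P0) big_mkord.
Qed.

Lemma pair_vec_graded P : P \in tp_pairs G -> graded_part (ptau P) (pair_vec P).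
Proof.
move/min_repP=> mP; exists (tmon (min_rep P)) => //.
by rewrite -(min_join_card mP) tmon_homog.
Qed.

Lemma coord_homog d x P : x \is d.-homog -> ptau P != d -> coord P x = 0.
Proof.
move=> hx Pd; rewrite /coord big1 // => J mJ.
apply: (dhomog_nemf_coeff hx); rewrite [X in X != _]mdeg_mset.
by rewrite (min_join_card mJ).
Qed.

(** A class of degree [d] has a homogeneous representative, whose coordinates vanish at every pair
    with [ptau] other than [d]. *)
Lemma has_dim_graded d :
  has_dim (@graded_part K V G d) #|[set P in tp_pairs G | ptau P == d]|.
Proof.
set r := enum [set P in tp_pairs G | ptau P == d].
rewrite cardE; exists (fun i : 'I_(size r) => pair_vec (nth (set0, 0) r i)).
apply: pair_vec_basis => [|P|P|x P [y hy /coord_eq ->] tpP].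
- exact: enum_uniq.
- by rewrite mem_enum inE => /andP[].
- by rewrite mem_enum inE => /andP[tpP /eqP <-]; apply: pair_vec_graded.
by rewrite mem_enum inE tpP /=; apply: coord_homog.
Qed.

(** * Multiplication by a variable, and the socle *)

Lemma coord_step P e x : ptau (pair_step P e) = (ptau P).+1 ->
  coord (pair_step P e) (tvar e * x) = coord P x.
Proof.
move=> tPe; rewrite [x]mpolyE mulr_sumr !linear_sum; apply: eq_bigr => m _ /=.
rewrite -scalerAr !linearZ /=; congr (_ * _).
case: (monomialP m) => [[J ->]|[f [m' ->]]]; last by rewrite mulrA !coord_square.
rewrite -tmonE -tmon1 coord_tmonM coord_tmon; congr (nat_of_bool _)%:R.
have := cards_symdiff J [set e]; rewrite cards1 setIC => cJ.
have := join_pair_flip J e => jJ.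
(* Adding [e] to a join [J] avoiding it raises both its size and the required minimum by one, so
   minimality is preserved both ways. *)
apply/andP/idP => [[dJ]|mJ].
  rewrite setUC -symdiff_disjoint; last by rewrite disjoint_sym.
  move=> mJ; have := min_join_pair mJ; rewrite jJ => /(can_inj (pair_stepK e)) jP.
  have := min_join_card mJ; rewrite (disjoint_setI0 dJ) cards0 addn0 addn1 in cJ.
  by rewrite cJ tPe /min_join jP eqxx /= => -[->].
have := ptau_le (symdiff J [set e]).
rewrite jJ (min_join_pair mJ) tPe => le_J; have cP := min_join_card mJ.
(* If [e] were in [J], removing it would give a join of [pair_step P e] that is too short. *)
have /eqP : #|[set e] :&: J| = 0%N by move: cJ le_J cP; move: #|_| #|_| #|_|; lia.
rewrite cards_eq0 setI_eq0 => dJ; split=> //.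
rewrite setUC -symdiff_disjoint; last by rewrite disjoint_sym.
rewrite /min_join jJ (min_join_pair mJ) eqxx /= tPe -cP.
by rewrite (disjoint_setI0 dJ) cards0 addn0 addn1 in cJ; rewrite cJ.
Qed.

(** At a pair outside [socle_pairs G] some [e] raises [ptau], and the coordinate of [x] reappears as
    one of [t_e x], which is zero in the quotient. *)
Lemma coord_socle x P : socle (eproj x) -> P \in tp_pairs G ->
  P \notin socle_pairs G -> coord P x = 0.
Proof.
move=> sx tpP nsP.
have [e tPe] : exists e, (ptau (pair_step P e)).+1 <> ptau P.
  apply/existsNP => sP; case/negP: nsP; apply/socle_pairsP; split=> //.
have {}tPe : ptau (pair_step P e) = (ptau P).+1 by case: (ptau_step e tpP).
rewrite -(coord_step x tPe) -[RHS](linear0 (coord (pair_step P e))).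
apply: coord_eq; rewrite rmorphM rmorph0; apply: sx.
exists [:: (1, tvar e)]; last by rewrite big_seq1 mul1r.
by move=> y; rewrite inE => /eqP -> /=; exists e.
Qed.

(** If [e] is in the minimum join, [t_e] creates a square; otherwise it gives a join two edges
    longer than the minimum for its pair. Both classes vanish. *)
Lemma pair_vec_socle P : P \in socle_pairs G -> socle (pair_vec P).
Proof.
case/socle_pairsP=> tpP sP x [s sS ->]; rewrite rmorph_sum mulr_suml.
rewrite big_seq big1 //= => -[a g] /sS /= [e ->].
rewrite rmorphM -mulrA -[X in _ * X]rmorphM /= -tmon1.
have [dJ|/tmonM_square[f [y ->]]] := boolP [disjoint [set e] & min_rep P]; last first.
  by rewrite eproj_squareM mulr0.
have mP := min_repP tpP.
have dJ' := dJ; rewrite disjoint_sym in dJ'.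
rewrite -tmonU // setUC -symdiff_disjoint // eproj_tmon join_pair_flip.
have := cards_symdiff (min_rep P) [set e]; rewrite (disjoint_setI0 dJ') cards0 cards1.
rewrite (min_join_pair mP) (min_join_card mP) => cJ.
rewrite (_ : _ == _ = false) ?scale0r ?mulr0 //.
move: cJ; rewrite addn0 addn1 => ->; rewrite -(sP e).
by apply/negbTE; rewrite neq_ltn leqW ?orbT.
Qed.

Lemma socle_basis (r : seq ({set V} * 'Z_2)) P0 : uniq r -> r =i socle_pairs G ->
  is_basis (@socle K V G) (fun i : 'I_(size r) => pair_vec (nth P0 r i)).
Proof.
move=> ur rS; apply: pair_vec_basis => // [P|P|x P]; rewrite rS.
- by case/socle_pairsP.
- exact: pair_vec_socle.
exact: coord_socle.
Qed.

Lemma socle_degreesP (r : seq ({set V} * 'Z_2)) : uniq r -> r =i socle_pairs G ->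
  socle_degrees K G [seq ptau P | P <- r].
Proof.
move=> ur rS; rewrite /socle_degrees size_map.
exists (fun i : 'I_(size r) => pair_vec (nth (set0, 0) r i)); first exact: socle_basis.
move=> i; rewrite (nth_map (set0, 0)) //; apply: pair_vec_graded.
have : nth (set0, 0) r i \in socle_pairs G by rewrite -rS mem_nth.
by case/socle_pairsP.
Qed.

Lemma has_type_socle_pairs (r : seq ({set V} * 'Z_2)) : uniq r ->
  r =i socle_pairs G -> has_type K G (size r).
Proof. by move=> ur rS; eexists; apply: (socle_basis (set0, 0) ur rS). Qed.

End Algebra.

(** Handshake argument: each edge toggles two vertices, which keeps the number of odd vertices even
    and adds at most two. *)
Lemma odd_vertices_card (V : finType) (G : sgraph V) (J : {set edge G}) :
  ~~ odd #|odd_vertices J| && (#|odd_vertices J| <= #|J|.*2)%N.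
Proof.
move: {2}#|J| (leqnn #|J|) => k; elim: k J => [|k IHk] J.
  by rewrite leqn0 cards_eq0 => /eqP ->; rewrite odd_vertices0 !cards0.
have [->|[e eJ]] := set_0Vmem J; first by rewrite odd_vertices0 !cards0.
move=> cJ; have cJe := cardsD1 e J; rewrite eJ in cJe.
have {IHk} /andP[ev le] := IHk (J :\ e) ltac:(by rewrite cJe in cJ).
have -> : J = symdiff (J :\ e) [set e].
  by apply/setP=> f; rewrite in_symdiff !inE; case: eqP => [->|] //=; rewrite addbF.
have ce := edges_card2 (valP e); rewrite odd_vertices_symdiff odd_vertices1.
rewrite odd_cards_symdiff ce addbF ev /=.
have := cards_symdiff (odd_vertices (J :\ e)) (val e); rewrite ce.
have := cards_symdiff (J :\ e) [set e].
rewrite cards1 (_ : (J :\ e) :&: [set e] = set0); last first.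
  by apply/setP=> f; rewrite !inE; case: eqP; rewrite ?andbF.
rewrite cards0; move: le; move: #|_| #|_| #|_| #|_| #|_|; lia.
Qed.

(** * Complete graphs *)

(** The value of [tau] at [(T, p)] for [t = #|T|] even and [b] the parity of [p]. The summand
    [b (+) odd t./2] corrects the parity of [t./2]; the value 3 is the triangle. *)
Definition complete_tau (t : nat) (b : bool) : nat :=
  (if t == 0 then if b then 3 else 0 else t./2 + (b (+) odd t./2))%N.

Lemma complete_tau_double k b : (0 < k)%N ->
  complete_tau k.*2 b = (k + (b (+) odd k))%N.
Proof. by case: k => // k _; rewrite /complete_tau doubleS /= doubleK. Qed.

Lemma complete_tau_double_eq k d : (0 < k)%N ->
  (complete_tau k.*2 (odd d) == d) = (k == d) || (k.+1 == d).
Proof.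
move=> k0; rewrite complete_tau_double //.
apply/eqP/idP => [|/orP[]/eqP <-]; last 2 first.
- by rewrite addbb addn0.
- by rewrite /= addNb addbb addn1.
by case: (_ (+) _) => <-; rewrite ?addn1 ?addn0 eqxx ?orbT.
Qed.

(** The socle condition for an edge with both ends in [T]. The bound on [k] keeps the smaller set
    non-empty. *)
Lemma complete_tau_pred k b : (1 < k)%N ->
  (complete_tau k.-1.*2 (~~ b)).+1 = complete_tau k.*2 b.
Proof.
case: k => [|[|k]] //= _; by rewrite !complete_tau_double //= !(addNb, addbN, negbK).
Qed.

(** The sizes of [T] occurring in degree [d] are [2d] and [2d - 2], except that the empty set counts
    in degree 3 instead of degree 1. *)
Lemma complete_tau_mem d t :
  ~~ odd t && (complete_tau t (odd d) == d) =
  if t == 0%N then (d == 0)%N || (d == 3)%N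
  else (t == d.*2)%N || (t.+2 == d.*2)%N.
Proof.
have [->|t0] := eqVneq t 0%N; first
  by case: d => [|[|[|[|d]]]] //=; rewrite /complete_tau /=; case: odd.
have [ot|et] := boolP (odd t); first by apply/esym/negbTE; lia.
have [k kE] : exists k, t = k.*2 by exists t./2; lia.
by rewrite kE complete_tau_double_eq; lia.
Qed.

(** * Short joins and the value of [tau] *)

Section CompleteGraph.
Variable V : finType.
Hypothesis cardV : (4 <= #|V|)%N.
Local Notation G := (complete_graph V).
Local Notation ptau := (ptau G).
Implicit Types (T : {set V}) (J : {set edge G}) (P : {set V} * 'Z_2).

(** A bound with fixed parity instead of an exact size, since toggling an edge may delete it. *)
Definition join_le T k : Prop :=
  exists J : {set edge G}, [/\ odd_vertices J = T, (#|J| <= k)%N & odd #|J| = odd k].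

Lemma complete_edgeP (u v : V) : u != v -> exists e : edge G, val e = [set u; v].
Proof.
move=> uv; have eG : [set u; v] \in edges G by rewrite inE cards2 uv.
by exists (exist (fun e => e \in edges G) _ eG).
Qed.

Lemma join_leS T k u v : u != v -> join_le (symdiff T [set u; v]) k -> join_le T k.+1.
Proof.
move=> /complete_edgeP[e eE] [J [oJ cJ pJ]]; exists (symdiff J [set e]).
rewrite odd_vertices_symdiff odd_vertices1 oJ eE symdiffK odd_cards_symdiff cards1 pJ.
split=> //; last by rewrite /= addbT.
have := cards_symdiff J [set e]; rewrite cards1.
by move: cJ; move: #|_| #|_| #|_|; lia.
Qed.

Lemma card_symdiff2 T u v : u != v ->
  (#|symdiff T [set u; v]| + ((u \in T) + (v \in T)).*2 = #|T| + 2)%N.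
Proof.
move=> uv; have := cards_symdiff T [set u; v]; rewrite cards2 uv => <-.
congr (_ + _.*2)%N; rewrite setIUr cardsU.
rewrite (_ : _ :&: (T :&: [set v]) = set0); last first.
  apply/setP=> w; rewrite !inE; case: (w =P u) => [->|]; last by rewrite andbF.
  by rewrite (negPf uv) !andbF.
rewrite cards0 subn0; congr (_ + _)%N; rewrite setIC.
  by case: (boolP (u \in T)) => uT; [rewrite (setIidPl _) ?sub1set ?cards1|
    rewrite (disjoint_setI0 _) ?cards0 ?disjoints1].
by case: (boolP (v \in T)) => uT; [rewrite (setIidPl _) ?sub1set ?cards1|
    rewrite (disjoint_setI0 _) ?cards0 ?disjoints1].
Qed.

Lemma join_le_half T : ~~ odd #|T| -> join_le T #|T|./2.
Proof.
move: {2}#|T|./2 (erefl #|T|./2) => k; elim: k T => [|k IHk] T eT evT.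
  have -> : T = set0 by apply/eqP; rewrite -cards_eq0; lia.
  by exists set0; rewrite odd_vertices0 !cards0.
have /card_gt1P[u [v [uT vT uv]]] : (1 < #|T|)%N by lia.
have := card_symdiff2 T uv; rewrite uT vT eT => cT.
apply: (join_leS uv); have eT' : #|symdiff T [set u; v]|./2 = k by lia.
by rewrite -eT'; apply: IHk => //; lia.
Qed.

(** The edge from [u] to [v] trades [u] for [v], at the cost of one edge and with the size of [T]
    unchanged. *)
Lemma join_le_halfS_proper T u v : ~~ odd #|T| -> u \in T -> v \notin T ->
  join_le T #|T|./2.+1.
Proof.
move=> evT uT vT; have uv : u != v by apply: contraNneq vT => <-.
have := card_symdiff2 T uv; rewrite uT (negPf vT) => cT.
have {}cT : #|symdiff T [set u; v]| = #|T| by lia.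
by apply: (join_leS uv); rewrite -cT; apply: join_le_half; rewrite cT.
Qed.

Lemma join_le_halfS T : ~~ odd #|T| -> T != set0 -> join_le T #|T|./2.+1.
Proof.
move=> evT T0; have [TT|] := boolP (T == setT); last first.
  rewrite -subTset => /subsetPn[v _ vT]; have /set0Pn[u uT] := T0.
  exact: join_le_halfS_proper uT vT.
have cT : #|T| = #|V| by rewrite (eqP TT) cardsT.
have /card_gt1P[u [v [uT vT uv]]] : (1 < #|T|)%N by lia.
have := card_symdiff2 T uv; rewrite uT vT => cT'.
have cT2 : #|T|./2 = #|symdiff T [set u; v]|./2.+1 by lia.
apply: (join_leS uv); rewrite cT2.
have /set0Pn[w wT] : symdiff T [set u; v] != set0.
  by rewrite -card_gt0; lia.
(* When [T] is everything, the vertex [u] just removed serves as the outside vertex; [4 <= #|V|]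
   leaves some [w] inside. *)
apply: (@join_le_halfS_proper _ w u) => //; first by lia.
by rewrite in_symdiff !inE eqxx uT.
Qed.

Lemma join_le_set0 : join_le set0 3.
Proof.
have /card_gt1P[u [v [_ _ uv]]] : (1 < #|V|)%N by lia.
(* A triangle: the edge [uv] and an even join of [[set u; v]]. *)
apply: (join_leS uv); rewrite symdiff0s.
have c2 : #|[set u; v]| = 2%N by rewrite cards2 uv.
by have := @join_le_halfS [set u; v]; rewrite -card_gt0 c2; apply.
Qed.

Lemma join_le_ptau P k : join_le P.1 k -> odd P.2 = odd k ->
  P \in tp_pairs G /\ (ptau P <= k)%N.
Proof.
case: P => T p [J [/= <- cJ pJ]] pk; have -> : p = #|J|%:R.
  by rewrite (natr_Z2 p) pk -pJ [RHS]natr_Z2 odd_natr_Z2.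
split; first exact: join_pair_in.
exact: leq_trans (ptau_le J) cJ.
Qed.

Lemma complete_ptau P : ~~ odd #|P.1| ->
  P \in tp_pairs G /\ ptau P = complete_tau #|P.1| (odd P.2).
Proof.
move=> evT.
have [tpP leP] : P \in tp_pairs G /\ (ptau P <= complete_tau #|P.1| (odd P.2))%N.
  apply: join_le_ptau; rewrite /complete_tau.
    rewrite cards_eq0; case: eqVneq => [->|T0].
      case: (odd _); first exact: join_le_set0.
      by have := @join_le_half set0; rewrite cards0; apply.
    case: (_ (+) _); first by rewrite /= addn1; apply: join_le_halfS.
    by rewrite /= addn0; apply: join_le_half.
  case: eqP => _; first by case: (odd _).
  by rewrite oddD oddb addbC addbK.
split=> //; apply/eqP; rewrite eqn_leq leP /=.
have [J mJ] := min_join_ex tpP; have := odd_vertices_card J.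
have := min_join_pair mJ; have := ptau_parity tpP; have := min_join_card mJ.
case: P {evT tpP leP mJ} => T p /= cJ pE [oJ _].
have -> : odd p = odd #|J| by rewrite pE -cJ odd_natr_Z2.
rewrite oJ -cJ; case/andP=> evT leT; rewrite /complete_tau; case: eqP => T0; last first.
  have : (#|T|./2 <= #|J|)%N by move: evT leT; move: #|_| #|_|; lia.
  rewrite leq_eqVlt => /orP[/eqP <-|ltT]; first by rewrite addbb addn0.
  by case: (_ (+) _); rewrite ?addn0 ?addn1 // ltnW.
case: (boolP (odd #|J|)) => pJ //; rewrite leqNgt; apply/negP => ltJ.
(* An odd join with fewer than three edges is a single edge, whose ends are odd vertices. *)
have /eqP/cards1P[e Je] : #|J| = 1%N by move: pJ ltJ; move: #|_|; lia.
have := edges_card2 (valP e); rewrite -odd_vertices1 -Je oJ T0 //.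
Qed.

Lemma complete_tp_pairs P : (P \in tp_pairs G) = ~~ odd #|P.1|.
Proof.
apply/idP/idP => [/tp_pairsP[J <-]|/complete_ptau[]//].
by have /andP[] := odd_vertices_card J.
Qed.

(** * Counting the pairs of a given degree *)

Lemma card_sets_of_card (f : pred nat) (r : seq nat) :
  uniq r -> (forall t, f t = (t \in r)) ->
  #|[set T : {set V} | f #|T|]| = (\sum_(t <- r) 'C(#|V|, t))%N.
Proof.
move=> + fr; rewrite (_ : [set T | _] = [set T : {set V} | #|T| \in r]); last first.
  by apply/setP=> T; rewrite !inE fr.
elim: r {fr} => [|t r IHr] /= => [_|/andP[tr ur]].
  by rewrite big_nil; apply/eqP; rewrite cards_eq0; apply/eqP/setP=> T; rewrite !inE.
rewrite big_cons -IHr // -card_draws -cardsUI.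
rewrite [X in (_ = _ + X)%N](_ : _ = 0%N) ?addn0.
  by congr #|pred_of_set _|; apply/setP=> T; rewrite !inE.
apply/eqP; rewrite cards_eq0; apply/eqP/setP=> T; rewrite !inE.
by case: eqP => // ->; apply/negbTE.
Qed.

Lemma card_graded_pairs d (r : seq nat) : uniq r ->
  (forall t, ~~ odd t && (complete_tau t (odd d) == d) = (t \in r)) ->
  #|[set P in tp_pairs G | ptau P == d]| = (\sum_(t <- r) 'C(#|V|, t))%N.
Proof.
move=> ur fr; rewrite -(card_sets_of_card ur fr).
(* The second component is the parity of [d], so only [T] is counted. *)
rewrite -(card_imset _ (fun T1 T2 (e : (T1, d%:R : 'Z_2) = (T2, _)) => congr1 fst e)).
congr #|pred_of_set _|; apply/setP=> -[T p]; rewrite inE complete_tp_pairs /=.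
apply/andP/imsetP => [[evT /eqP td]|[T' + [-> ->]]].
  have [tpT tT] := complete_ptau (P := (T, p)) evT.
  have pd : p = d%:R by rewrite -td; apply: (ptau_parity tpT).
  exists T; last by rewrite -pd.
  by rewrite inE evT -(odd_natr_Z2 d) -pd -tT td /=.
rewrite inE => /andP[evT /eqP td].
by have [_ ->] := complete_ptau (P := (T', d%:R)) evT; rewrite odd_natr_Z2 td.
Qed.

(** * Socle pairs of the complete graph *)

Lemma complete_socle_pairsP P : reflect
  (~~ odd #|P.1| /\ forall u v, u != v ->
    (complete_tau #|symdiff P.1 [set u; v]| (~~ odd P.2)).+1 =
    complete_tau #|P.1| (odd P.2))
  (P \in socle_pairs G).
Proof.
apply: (iffP (@socle_pairsP V G P)); rewrite complete_tp_pairs => -[evT sP]; split=> //.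
  have [tpP <-] := complete_ptau evT.
  move=> u v /complete_edgeP[e eE]; rewrite -(sP e) -eE -odd_Z2S.
  have := pair_step_in e tpP; rewrite complete_tp_pairs => /complete_ptau[_ ->] //.
move=> e; have [tpP ->] := complete_ptau evT.
have := pair_step_in e tpP; rewrite complete_tp_pairs => /complete_ptau[_ ->].
have /eqP/cards2P[u [v [uv eE]]] := edges_card2 (valP e).
by rewrite /pair_step /= eE odd_Z2S; apply: sP.
Qed.

Lemma socle_pair_set0 : (set0, 1) \in socle_pairs G.
Proof.
apply/complete_socle_pairsP; split; rewrite /= ?cards0 // => u v uv.
by rewrite symdiff0s cards2 uv.
Qed.

Lemma socle_pair_card P : P \in socle_pairs G ->
  P = (set0, 1) \/ (0 < #|P.1| /\ #|V| <= #|P.1|.+1)%N.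
Proof.
case/complete_socle_pairsP=> evT sP; have [T0|T0] := posnP #|P.1|.
  left; have /card_gt1P[u [v [_ _ uv]]] : (1 < #|V|)%N by lia.
  have := sP _ _ uv; move/eqP: T0; rewrite cards_eq0; case: P {evT sP} => T p /= /eqP ->.
  rewrite cards0 /complete_tau /=; case: (boolP (odd p)) => // pp _.
  by rewrite (natr_Z2 p) pp.
right; split=> //; rewrite leqNgt; apply/negP => ltT.
(* An edge joining two vertices outside [T] would raise [tau]. *)
have /card_gt1P[u [v []]] : (1 < #|~: P.1|)%N.
  by have := cardsC P.1; move: ltT; move: #|_| #|_| #|_|; lia.
rewrite !inE => uT vT uv; have := sP _ _ uv; have := card_symdiff2 P.1 uv.
rewrite (negPf uT) (negPf vT) addn0 => ->.
have [k kE] : exists k, #|P.1| = k.*2 by exists #|P.1|./2; lia.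
rewrite kE in T0 *; rewrite addn2 -doubleS !complete_tau_double //=; last by lia.
by rewrite addNb addbN negbK; move: (_ (+) _); lia.
Qed.

Lemma card_eq_pred_notin T u v :
  #|T| = #|V|.-1 -> u != v -> (u \in T) || (v \in T).
Proof.
move=> cT uv; case: (boolP (u \in T)) => //= uT; apply/negPn/negP => vT.
have : (1 < #|~: T|)%N by apply/card_gt1P; exists u, v; rewrite !inE.
by have := cardsC T; rewrite cT; move: cardV; move: #|_| #|_|; lia.
Qed.

(** Here [T] misses one vertex and [#|T| = 2k]. Edges inside [T] lower [tau] for either parity; an
    edge to the missing vertex keeps [#|T|] and flips [p], so it lowers [tau] exactly when [p] is
    the parity of [k + 1]. *)
Lemma socle_pair_odd P : odd #|V| ->
  (P \in socle_pairs G) =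
  (P == (set0, 1)) || ((#|P.1| == #|V|.-1) && (P.2 == #|V|.+1./2%:R)).
Proof.
move=> oV; have [k [k1 eV]] : exists k, (1 < k)%N /\ #|V| = k.*2.+1.
  by exists #|V|./2; lia.
have -> : #|V|.+1./2 = k.+1 by lia.
apply/idP/orP => [sP|[/eqP ->|/andP[/eqP cT /eqP pE]]]; first last.
- have cT2 : #|P.1| = k.*2 by rewrite cT eV.
  apply/complete_socle_pairsP; rewrite pE odd_natr_Z2 cT2 odd_double; split=> // u v uv.
  have := card_symdiff2 P.1 uv; have := card_eq_pred_notin cT uv; rewrite cT2.
  case: (u \in _) (v \in _) => [] [] //= _ cT'; last 2 first.
  + have -> : #|symdiff P.1 [set u; v]| = k.*2 by lia.
    by rewrite !complete_tau_double ?negbK ?addbb ?addNb ?addbb ?addn0 ?addn1 //; lia.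
  + have -> : #|symdiff P.1 [set u; v]| = k.*2 by lia.
    by rewrite !complete_tau_double ?negbK ?addbb ?addNb ?addbb ?addn0 ?addn1 //; lia.
  have -> : #|symdiff P.1 [set u; v]| = k.-1.*2 by lia.
  by rewrite complete_tau_pred.
- exact: socle_pair_set0.
have [->|[T0 ltV]] := socle_pair_card sP; [by left|right].
have /complete_socle_pairsP[evT {}sP] := sP.
have cT : #|P.1| = k.*2.
  by have := max_card (mem P.1); move: evT ltV; rewrite eV; move: #|_|; lia.
have /card_gt0P[u uT] := T0.
have [v vT] : exists v, v \notin P.1.
  have /card_gt0P[v] : (0 < #|~: P.1|)%N.
    by have := cardsC P.1; rewrite cT eV; move: #|_|; lia.
  by rewrite inE; exists v.
have uv : u != v by apply: contraNneq vT => <-.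
have := card_symdiff2 P.1 uv; rewrite uT (negPf vT) => /addIn cT'.
have := sP _ _ uv; rewrite cT' cT !complete_tau_double //; last 2 first.
- by lia.
- by lia.
rewrite eV eqxx addNb [X in X == _](natr_Z2 P.2) eq_natr_Z2 oddb /=.
by case: (odd P.2) (odd k) => [] []; rewrite ?addn0 ?addn1 //=; lia.
Qed.

(** Parity excludes missing one vertex, so [T] is everything; all edges are then inside [T] and both
    parities occur. *)
Lemma socle_pair_even P : ~~ odd #|V| ->
  (P \in socle_pairs G) = (P == (set0, 1)) || (P.1 == setT).
Proof.
move=> eV; have [k [k1 {}eV]] : exists k, (1 < k)%N /\ #|V| = k.*2.
  by exists #|V|./2; lia.
apply/idP/orP => [sP|[/eqP ->|/eqP TT]]; first last.
- apply/complete_socle_pairsP; rewrite TT cardsT eV odd_double; split=> // u v uv.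
  have := card_symdiff2 setT uv; rewrite !inE cardsT eV => cT'.
  have -> : #|symdiff setT [set u; v]| = k.-1.*2 by lia.
  by rewrite complete_tau_pred.
- exact: socle_pair_set0.
have [->|[T0 ltV]] := socle_pair_card sP; [by left|right].
have /complete_socle_pairsP[evT _] := sP.
rewrite eqEcard subsetT cardsT.
by have := max_card (mem P.1); move: evT ltV; rewrite eV; move: #|_|; lia.
Qed.

Lemma has_dim_complete (K : fieldType) d (r : seq nat) : uniq r ->
  (forall t, ~~ odd t && (complete_tau t (odd d) == d) = (t \in r)) ->
  has_dim (@graded_part K V G d) (\sum_(t <- r) 'C(#|V|, t))%N.
Proof.
by move=> ur fr; rewrite -(card_graded_pairs ur fr); apply: has_dim_graded.
Qed.

End CompleteGraph.

Theorem theorem4p2 (K : fieldType) (n : nat) (V : finType)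
  (n_ge4 : (4 <= n)%N) (cardV : #|V| = n) :
  let G := complete_graph V in
  [/\ [/\ has_dim (@graded_part K V G 1) 'C(n, 2),
          has_dim (@graded_part K V G 3) (1 + 'C(n, 4) + 'C(n, 6))%N
        & forall i : nat, i <> 1%N -> i <> 3%N ->
            has_dim (@graded_part K V G i)
              (binz n (2 * i%:Z - 2) + binz n (2 * i%:Z))%N],
      odd n ->
        [/\ socle_pairs G =
              (set0, 1) |: [set (T, (n.+1./2)%:R) | T : {set V} & #|T| == n.-1],
            has_type K G n.+1
          & socle_degrees K G (3 :: nseq n n.+1./2)%N]
    & ~~ odd n ->
        [/\ socle_pairs G = [set (set0, 1); (setT, 0); (setT, 1)],
            has_type K G 3
          & socle_degrees K G [:: 3; n./2; n./2.+1]%N]].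
Proof.
move=> G; have V4 : (4 <= #|V|)%N by rewrite cardV.
have tauE P : P \in socle_pairs G -> ptau G P = complete_tau #|P.1| (odd P.2).
  by case/complete_socle_pairsP=> // evT _; have [] := complete_ptau V4 evT.
split; [split|move=> on|move=> en].
- have := @has_dim_complete V V4 K 1 [:: 2]; rewrite big_seq1 cardV; apply=> // t.
  by rewrite complete_tau_mem inE; case: t => [|[|[]]].
- have := @has_dim_complete V V4 K 3 [:: 0; 4; 6]; rewrite !big_cons big_nil bin0 cardV.
  rewrite addn0 addnA; apply=> // t.
  by rewrite complete_tau_mem !inE; case: t => [|[|[|[|[|[|[]]]]]]].
- case=> [_ _|[//|i _ i3]].
    (* For [i = 0] the lower index [-2] makes the first [binz] zero. *)
    have := @has_dim_complete V V4 K 0 [:: 0]; rewrite big_seq1 cardV; apply=> // t.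
    by rewrite complete_tau_mem inE; case: t.
  have -> : 2 * i.+2%:Z - 2 = (i.+1.*2)%:Z by lia.
  have -> : 2 * i.+2%:Z = (i.+2.*2)%:Z by lia.
  have := @has_dim_complete V V4 K i.+2 [:: i.+1.*2; i.+2.*2].
  rewrite !big_cons big_nil addn0 cardV; apply=> [|t]; first by rewrite /= inE; lia.
  by rewrite complete_tau_mem !inE; case: eqP => [->|_]; lia.
- have sE : socle_pairs G =
      (set0, 1) |: [set (T, (n.+1./2)%:R) | T : {set V} & #|T| == n.-1].
    apply/setP=> -[T p]; rewrite socle_pair_odd ?cardV // in_setU1; congr (_ || _).
    apply/andP/imsetP => /= [[cT /eqP ->]|[T' + [-> ->]]]; first
      by exists T; rewrite ?inE.
    by rewrite inE eqxx.
  pose A := [set T : {set V} | #|T| == n.-1].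
  pose r : seq ({set V} * 'Z_2) := (set0, 1) :: [seq (T, (n.+1./2)%:R) | T <- enum A].
  have ur : uniq r.
    rewrite /= map_inj_uniq ?enum_uniq ?andbT => [|T1 T2 [] //].
    apply/mapP => -[T]; rewrite mem_enum inE => /eqP + [T0].
    by rewrite -T0 cards0; lia.
  have rS : r =i socle_pairs G.
    move=> P; rewrite sE inE in_setU1; congr (_ || _).
    by apply/mapP/imsetP => -[T TA ->]; exists T; rewrite ?mem_enum // -?mem_enum in TA *.
  have cA : size (enum A) = n.
    rewrite -cardE card_draws cardV -{1}(prednK (ltnW (ltnW (ltnW n_ge4)))) binSn.
    by rewrite prednK //; lia.
  have sr : size r = n.+1 by rewrite /= size_map cA.
  split=> //; first by rewrite -sr; apply: has_type_socle_pairs.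
  have := socle_degreesP K ur rS; congr socle_degrees; rewrite /=; congr (_ :: _).
    by rewrite tauE ?socle_pair_set0 //= cards0.
  rewrite -map_comp; set f := _ \o _.
  transitivity (nseq (size [seq f T | T <- enum A]) n.+1./2); last first.
    by rewrite size_map cA.
  apply/all_pred1P; rewrite all_map; apply/allP=> T TA.
  have /tauE tT : (T, (n.+1./2)%:R) \in socle_pairs G.
    by rewrite -rS inE orbC (map_f (fun T => (T, _))).
  move: TA; rewrite mem_enum inE /f /= tT /= => /eqP ->; apply/eqP.
  have [k [k0 kn]] : exists k, (0 < k)%N /\ n = k.*2.+1 by exists n./2; lia.
  rewrite odd_natr_Z2 kn /= doubleK complete_tau_double //.
  by rewrite /= addNb addbb addn1.
- have sE : socle_pairs G = [set (set0, 1); (setT, 0); (setT, 1)].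
    apply/setP=> -[T p]; rewrite socle_pair_even ?cardV // !inE -!orbA.
    congr (_ || _); rewrite !xpair_eqE -andb_orr.
    by rewrite -[LHS]andbT; congr (_ && _); case: p => -[|[|]].
  (* The pairs over [setT] are ordered by [tau], whichever of [n./2] and [n./2.+1] is even. *)
  pose r : seq ({set V} * 'Z_2) :=
    [:: (set0, 1); (setT, (n./2)%:R); (setT, (n./2.+1)%:R)].
  have nT0 : (set0 == [set: V]) = false.
    by apply/negbTE; rewrite eq_sym -card_gt0 cardsT cardV; lia.
  have ur : uniq r.
    by rewrite /= !inE !xpair_eqE nT0 eqxx /= eq_natr_Z2 /=; case: odd.
  have rS : r =i socle_pairs G.
    move=> P; rewrite sE !inE -!orbA; congr (_ || _).
    case: P => T p; rewrite !xpair_eqE -!andb_orr; congr (_ && _).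
    rewrite -natr1 (natr_Z2 (n./2)%:R) odd_natr_Z2.
    by case: odd; case: p => -[|[|]].
  split=> //; first exact: has_type_socle_pairs ur rS.
  have := socle_degreesP K ur rS; congr socle_degrees; rewrite /=.
  have [k [k0 kn]] : exists k, (0 < k)%N /\ n = k.*2 by exists n./2; lia.
  rewrite !tauE ?socle_pair_set0 -?rS ?inE ?eqxx ?orbT //= cards0 cardsT cardV.
  rewrite !odd_natr_Z2 kn doubleK !complete_tau_double //=.
  by rewrite addbb addn0 addNb addbb addn1.
Qed.
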